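(* Let $\psi: T \to \mathbb{C}$ be a function and $\varphi: T \to T$ a self-map for which $W_{\psi,\varphi}$ is bounded on $L_\mu^\infty$. Then $W_{\psi,\varphi}$ is Fredholm (on $L_\mu^\infty$) if and only if all of the following hold: (a) $T\setminus\varphi(T)$ is finite; (b) there exists $M \in \mathbb{N}$ such that $\varphi^{-1}(w)$ contains at most $M$ points for every $w \in \varphi(T)$; (c) $\varphi^{-1}(w)$ contains exactly one element for all but a finite number of points $w \in \varphi(T)$; (d) $Z = \{v \in T : \psi(v) = 0\}$ is finite; (e) there is an $\varepsilon > 0$ such that $U_\varepsilon \cap S_w \ne \emptyset$ for every $w \in Z^c = T \setminus Z$, where $$U_\varepsilon = \left\{v \in T : \frac{\mu(v)}{\mu(\varphi(v))}|\psi(v)| \ge \varepsilon\right\}, \qquad S_w = \{v \in T : \varphi(v) = \varphi(w)\}.$$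
   Context: $(T,\mathrm{d})$ is a metric space with a distinguished point $o$ (the root); the length of $v \in T$ is $|v| = \mathrm{d}(o,v)$. $T$ is assumed locally finite (for every $M>0$ the set $\{v \in T : |v| < M\}$ is finite) and unbounded (for every $M>0$ there is $v \in T$ with $|v| \ge M$). $\mu: T \to (0,\infty)$ is an arbitrary positive function (a weight). $L_\mu^\infty$ is the Banach space of functions $f: T \to \mathbb{C}$ with $\|f\|_\mu = \sup_{v \in T} \mu(v)|f(v)| < \infty$. The weighted composition operator is the linear map $W_{\psi,\varphi} f = \psi\,(f\circ\varphi)$; it is bounded on $L_\mu^\infty$ if it is a bounded operator from $L_\mu^\infty$ to itself. Here $\varphi^{-1}(w)$ denotes the preimage $\{v \in T : \varphi(v) = w\}$. A bounded operator $A$ on a Banach space is Fredholm if it has closed range and both $\ker(A)$ and $\ker(A^* )$ are finite dimensional, where $A^*$ is the adjoint on the dual space; equivalently, there is a bounded operator $S$ such that $SA - I$ and $AS - I$ are both compact. *)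

(* Defs.v *)
From HB Require Import structures.
From mathcomp Require Import all_boot all_order all_algebra.
From mathcomp Require Import complex.
From mathcomp Require Import mathcomp_extra boolp classical_sets functions.
From mathcomp Require Import cardinality reals interval_inference.
From mathcomp Require Import topology normedtype.

Set Implicit Arguments.
Unset Strict Implicit.
Unset Printing Implicit Defensive.

Import Order.TTheory GRing.Theory Num.Theory.
Import numFieldNormedType.Exports.

Local Open Scope classical_set_scope.
Local Open Scope complex_scope.
Local Open Scope ring_scope.

Notation modulus := Normc.normc.

(* The subset S of V is a finite-dimensional linear subspace. *)
Definition finite_dim (K : numFieldType) (V : lmodType K) (S : set V) : Prop :=
  exists (n : nat) (e : 'I_n -> V),
    S = [set x | exists c : 'I_n -> K, x = \sum_(i < n) c i *: e i].

Section Operators.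
Context (K : numFieldType).

Definition bounded_op (V W : normedModType K) (A : V -> W) : Prop :=
  linear A /\ exists M : K, forall x, `|A x| <= M * `|x|.

(* The dual space is kept as a subset of the K-module of all functions
   V -> K, and the adjoint acts on that ambient module. *)
Definition dual_space (V : normedModType K) : set (V -> K^o) :=
  [set l | bounded_op l].

Definition adjoint (V W : normedModType K) (A : V -> W) (l : W -> K^o) :
  V -> K^o := l \o A.

Lemma adjoint_dual (V W : normedModType K) (A : V -> W) (l : W -> K^o) :
  bounded_op A -> dual_space l -> dual_space (adjoint A l).
Proof.
move=> [Alin [M AM]] [llin [N lN]]; split=> [a x y|].
  by rewrite /adjoint /= Alin llin.
have [x0|x0] := pselect (exists x, l x != 0); last first.
  exists 0 => x; rewrite mul0r /adjoint /=.
  have -> : l (A x) = 0; last by rewrite normr0.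
  by apply/eqP/negPn/negP => lAx; apply: x0; exists (A x).
have [x lx] := x0.
have Ngt0 : 0 < N * `|x| by rewrite (lt_le_trans _ (lN x))// normr_gt0.
have N0 : 0 <= N.
  have x1 : 0 < `|x|.
    rewrite normr_gt0; apply: contraTneq Ngt0 => ->.
    by rewrite normr0 mulr0 ltxx.
  by rewrite pmulr_lgt0// in Ngt0; exact: ltW.
exists (N * M) => y; rewrite -mulrA.
by apply: (le_trans (lN _)); rewrite ler_wpM2l.
Qed.

Definition fredholm (V : completeNormedModType K) (A : V -> V) : Prop :=
  [/\ bounded_op A,
      closed (range A),
      finite_dim [set x | A x = 0] &
      finite_dim (@dual_space V `&` [set l | adjoint A l = 0])].

End Operators.

Section Modulus.
Context (R : rcfType).
Implicit Types (z : R[i]) (x y : R).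

Lemma modulusE z : `|z| = (modulus z)%:C. Proof. by case: z. Qed.

Lemma modulus_ge0 z : 0 <= modulus z.
Proof. by rewrite -lecR -modulusE normr_ge0. Qed.

Lemma modulusD z1 z2 : modulus (z1 + z2) <= modulus z1 + modulus z2.
Proof. exact: le_normcD. Qed.

Lemma modulus_realC x : modulus x%:C = `|x|.
Proof. by rewrite /Normc.normc /= expr0n addr0 sqrtr_sqr. Qed.

Lemma Re_le_modulus z : `|complex.Re z| <= modulus z.
Proof. by rewrite -lecR -modulusE normc_ge_Re. Qed.

Lemma Im_le_modulus z : `|complex.Im z| <= modulus z.
Proof.
case: z => a b /=; rewrite -sqrtr_sqr ler_sqrt ?lerDr ?sqr_ge0//.
by rewrite addr_ge0 ?sqr_ge0.
Qed.

Lemma modulus_le_ReIm z : modulus z <= `|complex.Re z| + `|complex.Im z|.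
Proof.
have -> : z = (complex.Re z)%:C + (0 +i* complex.Im z).
  by case: z => a b; apply/eqP; rewrite eq_complex /= addr0 add0r !eqxx.
apply: (le_trans (modulusD _ _)); rewrite modulus_realC /=.
by rewrite expr0n add0r sqrtr_sqr addr0 add0r.
Qed.

Lemma gt0_complexE z : 0 < z -> z = (complex.Re z)%:C /\ 0 < complex.Re z.
Proof.
case: z => a b; rewrite ltcE /= => /andP[/eqP -> a0]; split => //.
Qed.

End Modulus.

Section ComplexComplete.
Context (R : realType).

Lemma complex_complete (F : set_system (R[i])^o) :
  ProperFilter F -> cauchy F -> cvg F.
Proof.
move=> FF /cauchy_ballP Fc.
have Rc (p : R[i] -> R) (pB : forall x y, p (x - y) = p x - p y)
    (ple : forall x, `|p x| <= modulus x) : cvg (p @ F).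
  apply: R_complete; apply/cauchy_ballP => e e0.
  have e0C : 0 < e%:C by rewrite ltcR.
  have := Fc _ e0C; case=> -[A B] /= [FA FB] AB.
  exists (p @` A, p @` B) => /=.
    split; [apply: filterS FA|apply: filterS FB] => z Az /=; exists z => //.
  move=> [_ _] /= [[x Ax <-] [y By <-]].
  have := AB (x, y) (conj Ax By).
  rewrite -!ball_normE /ball_ /= modulusE ltcR -pB; apply: le_lt_trans.
  exact: ple.
have Rcvg : cvg (@complex.Re R @ F) by apply: Rc => [[? ?] [? ?]|x] //; exact: Re_le_modulus.
have Icvg : cvg (@complex.Im R @ F) by apply: Rc => [[? ?] [? ?]|x] //; exact: Im_le_modulus.
apply/cvg_ex; exists (lim (@complex.Re R @ F) +i* lim (@complex.Im R @ F)).
apply/cvgrPdist_lt => eps /gt0_complexE[-> +].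
move: (complex.Re eps) => {eps} e e0.
have e20 : 0 < e / 2 by rewrite divr_gt0.
move/cvgrPdist_lt/(_ _ e20) : Rcvg => HR.
move/cvgrPdist_lt/(_ _ e20) : Icvg => HI.
near=> z.
rewrite modulusE ltcR; apply: (le_lt_trans (modulus_le_ReIm _)).
rewrite [ltRHS]splitr ltrD//.
  have : `|lim (@complex.Re R @ F) - complex.Re z| < e / 2 by near: z.
  by case: {+}z.
have : `|lim (@complex.Im R @ F) - complex.Im z| < e / 2 by near: z.
by case: {+}z.
Unshelve. all: by end_near. Qed.

HB.instance Definition _ := Uniform_isComplete.Build (R[i])^o complex_complete.

End ComplexComplete.

Section WeightedSpace.
Context (R : realType) (T : Type) (mu : T -> {posnum R}).
Implicit Types f g : T -> R[i].

Definition weighted_mod f (v : T) : R := (mu v)%:num * modulus (f v).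

Definition Linf_pred : {pred T -> R[i]} :=
  mem [set f | has_ubound (range (weighted_mod f))].

Record Linf : Type := MkLinf {
  Linf_fun :> T -> R[i] ;
  Linf_bounded : Linf_fun \in Linf_pred
}.

HB.instance Definition _ := [isSub for Linf_fun].
HB.instance Definition _ := [Choice of Linf by <:].

Lemma Linf_predP f :
  f \in Linf_pred <-> exists M, forall v, weighted_mod f v <= M.
Proof.
rewrite inE; split=> [[M fM]|[M fM]]; exists M.
  by move=> v; apply: fM; exists v.
by move=> _ [v _ <-].
Qed.

Lemma weighted_mod_ge0 f v : 0 <= weighted_mod f v.
Proof. by rewrite mulr_ge0// modulus_ge0. Qed.

Lemma weighted_modD f g v :
  weighted_mod (f + g) v <= weighted_mod f v + weighted_mod g v.
Proof. by rewrite -mulrDr ler_wpM2l// modulusD. Qed.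

Lemma weighted_modZ a f v :
  weighted_mod (a *: f) v = modulus a * weighted_mod f v.
Proof. by rewrite /weighted_mod [modulus (_ v)]Normc.normcM mulrCA. Qed.

Lemma Linf_submod_closed : submod_closed Linf_pred.
Proof.
split.
  apply/Linf_predP; exists 0 => v.
  by rewrite /weighted_mod [modulus (_ v)]Normc.normc0 mulr0.
move=> a f g /Linf_predP[M fM] /Linf_predP[N gN].
apply/Linf_predP; exists (modulus a * M + N) => v.
apply: (le_trans (weighted_modD _ _ _)).
by rewrite lerD// weighted_modZ ler_wpM2l ?modulus_ge0.
Qed.

HB.instance Definition _ :=
  GRing.isSubmodClosed.Build _ _ Linf_pred Linf_submod_closed.
HB.instance Definition _ := [SubChoice_isSubLmodule of Linf by <:].

Definition Linf_norm (f : Linf) : R := sup (range (weighted_mod f)).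

Lemma weighted_mod_le_norm (f : Linf) v : weighted_mod f v <= Linf_norm f.
Proof.
apply: ub_le_sup; last by exists v.
by have := Linf_bounded f; rewrite inE.
Qed.

Lemma Linf_norm_le (f : Linf) (M : R) :
  0 <= M -> (forall v, weighted_mod f v <= M) -> Linf_norm f <= M.
Proof.
move=> M0 fM; rewrite /Linf_norm.
have [->|/set0P Tn0] := eqVneq (range (weighted_mod f)) set0.
  by rewrite sup0.
by apply: ge_sup => // _ [v _ <-].
Qed.

Lemma Linf_norm_ge0 (f : Linf) : 0 <= Linf_norm f.
Proof.
rewrite /Linf_norm; have [->|/set0P[_ [v _ _]]] :=
  eqVneq (range (weighted_mod f)) set0; first by rewrite sup0.
exact: le_trans (weighted_mod_ge0 f v) (weighted_mod_le_norm f v).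
Qed.

Lemma Linf_ler_normD (f g : Linf) :
  (Linf_norm (f + g))%:C <= (Linf_norm f)%:C + (Linf_norm g)%:C.
Proof.
rewrite -rmorphD lecR; apply: Linf_norm_le => [|v].
  by rewrite addr_ge0 ?Linf_norm_ge0.
by apply: (le_trans (weighted_modD f g v)); rewrite lerD ?weighted_mod_le_norm.
Qed.

Lemma Linf_normrZ (a : R[i]) (f : Linf) :
  (Linf_norm (a *: f))%:C = `|a| * (Linf_norm f)%:C.
Proof.
have le_normZ (b : R[i]) (g : Linf) :
    Linf_norm (b *: g) <= modulus b * Linf_norm g.
  apply: Linf_norm_le => [|v].
    by rewrite mulr_ge0 ?modulus_ge0 ?Linf_norm_ge0.
  rewrite [leLHS](weighted_modZ b g v).
  by rewrite ler_wpM2l ?modulus_ge0 ?weighted_mod_le_norm.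
rewrite modulusE -rmorphM; congr (_%:C); apply/eqP; rewrite eq_le le_normZ /=.
have [->|a0] := eqVneq a 0.
  by rewrite Normc.normc0 mul0r Linf_norm_ge0.
have ma0 : 0 < modulus a.
  rewrite lt_neqAle modulus_ge0 andbT eq_sym.
  by apply: contra a0 => /eqP/Normc.eq0_normc ->.
have := le_normZ a^-1 (a *: f).
by rewrite scalerA mulVf// scale1r Normc.normcV ler_pdivlMl.
Qed.

Lemma Linf_normr0_eq0 (f : Linf) : (Linf_norm f)%:C = 0 -> f = 0.
Proof.
move=> /(congr1 (@complex.Re R)) /= f0; apply/val_inj/funext => v /=.
have := weighted_mod_le_norm f v; rewrite f0 /weighted_mod.
rewrite pmulr_rle0// => fv0; apply: Normc.eq0_normc; apply/eqP.
by rewrite eq_le fv0 modulus_ge0.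
Qed.

HB.instance Definition _ := Lmodule_isNormed.Build R[i] Linf
  Linf_ler_normD Linf_normrZ Linf_normr0_eq0.

(* The norm of a normedModType over R[i] takes its values in R[i]. *)
Lemma Linf_normE (f : Linf) : `|f| = (Linf_norm f)%:C. Proof. by []. Qed.

Lemma Linf_complete (F : set_system Linf) :
  ProperFilter F -> cauchy F -> cvg F.
Proof.
move=> FF /cauchy_ballP Fc.
have evc v : cvg ((fun f : Linf => f v : (R[i])^o) @ F).
  apply: complex_complete; apply/cauchy_ballP => eps /gt0_complexE[-> +].
  move: (complex.Re eps) => {eps} e e0.
  have e0C : 0 < ((mu v)%:num * e)%:C by rewrite ltcR mulr_gt0.
  have := Fc _ e0C; case=> -[A B] /= [FA FB] AB.
  exists ((fun f : Linf => f v) @` A, (fun f : Linf => f v) @` B) => /=.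
    by split; [apply: filterS FA|apply: filterS FB] => z Az /=; exists z.
  move=> [_ _] /= [[f Af <-] [g Bg <-]].
  have := AB (f, g) (conj Af Bg).
  rewrite -!ball_normE /ball_ /= modulusE !ltcR => fge.
  rewrite -(ltr_pM2l (gt0 (mu v))).
  exact: le_lt_trans (weighted_mod_le_norm (f - g) v) fge.
pose l : T -> R[i] := fun v => lim ((fun f : Linf => f v : (R[i])^o) @ F).
have lF (e : R) : 0 < e ->
    \forall f \near F, forall v, weighted_mod (l - Linf_fun f) v <= e.
  move=> e0; have e20 : 0 < e / 2 by rewrite divr_gt0.
  have e20C : 0 < (e / 2)%:C by rewrite ltcR.
  have := Fc _ e20C; case=> -[A B] /= [FA FB] AB.
  apply: filterS FB => g Bg v.
  have d0 : 0 < (e / 2 / (mu v)%:num)%:C by rewrite ltcR divr_gt0.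
  move: (evc v) => /cvgrPdist_lt/(_ _ d0) lv.
  have [f [Af]] := filter_ex (filterI FA lv).
  rewrite modulusE ltcR ltr_pdivlMr// mulrC => flv.
  have := AB (f, g) (conj Af Bg).
  rewrite -!ball_normE /ball_ /= ltcR => fge.
  have -> : l - Linf_fun g =
      (l - Linf_fun f) + (Linf_fun f - Linf_fun g).
    by rewrite addrA subrK.
  apply: (le_trans (weighted_modD _ _ _)); rewrite [leRHS]splitr.
  apply: lerD; first exact: ltW.
  exact: le_trans (weighted_mod_le_norm (f - g) v) (ltW fge).
have lL : l \in Linf_pred.
  have [f fl] := filter_ex (lF _ ltr01).
  have -> : l = (l - Linf_fun f) + Linf_fun f by rewrite subrK.
  rewrite rpredD ?Linf_bounded//; apply/Linf_predP; exists 1.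
  exact: fl.
apply/cvg_ex; exists (MkLinf lL).
apply/cvgrPdist_le => eps /gt0_complexE[-> +].
move: (complex.Re eps) => {eps} e e0.
apply: filterS (lF _ e0) => f fl.
rewrite Linf_normE lecR; apply: Linf_norm_le; first exact: ltW.
exact: fl.
Qed.

HB.instance Definition _ := Uniform_isComplete.Build Linf Linf_complete.

End WeightedSpace.

Section WeightedComposition.
Context (R : realType) (T : Type).
Variables (mu : T -> {posnum R}) (psi : T -> R[i]) (phi : T -> T).

Definition wcomp (f : T -> R[i]) : T -> R[i] := fun v => psi v * f (phi v).

Definition zeros : set T := [set v | psi v = 0].

Definition level_set (eps : R) : set T :=
  [set v | eps <= (mu v)%:num / (mu (phi v))%:num * modulus (psi v)].

Definition fiber_of (w : T) : set T := [set v | phi v = phi w].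

End WeightedComposition.

(* Main.v *)
(* Choose for every u in the range of phi a point r u of its fiber, outside the
   zeros of psi whenever possible. Every g in the range of W satisfies
   g v = psi v / psi (r (phi v)) * g (r (phi v)), a relation which is trivial
   unless v is redundant, i.e. v <> r (phi v) or psi v = 0. The relations at
   redundant points are biorthogonal to the indicators of these points, so a
   finite-dimensional dual kernel forces finitely many redundant points, which
   is (b), (c) and (d); (a) comes from the indicators of the points outside the
   range of phi, which lie in the kernel. For (e), let a u be the supremum of
   mu v / mu u * |psi v| over the fiber of u and h u := 1 / (mu u * sqrt (a u)).
   Truncations of h show that psi * (h o phi) lies in the closure of the range
   of W; once the range is closed, h must be weight-bounded where it matters,
   which bounds a from below.
   Conversely (e) allows dividing by psi, so the range of W is exactly the set of
   g satisfying all the relations: it is closed, and the dual kernel is spanned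
   by the relations at the redundant points. *)

Require Import Defs.
From HB Require Import structures.
From mathcomp Require Import all_boot all_order all_algebra.
From mathcomp Require Import complex finmap.
From mathcomp Require Import mathcomp_extra boolp classical_sets functions.
From mathcomp Require Import cardinality reals interval_inference.
From mathcomp Require Import topology normedtype.

Set Implicit Arguments.
Unset Strict Implicit.
Unset Printing Implicit Defensive.

Import Order.TTheory GRing.Theory Num.Theory.
Import numFieldNormedType.Exports.

Local Open Scope classical_set_scope.
Local Open Scope complex_scope.
Local Open Scope card_scope.
Local Open Scope ring_scope.

(** * Linear algebra: biorthogonal families and finite spans *)

Lemma linear_combE (K : numFieldType) (V : lmodType K) (l : V -> K^o)
    (I : Type) (s : seq I) (c : I -> K) (x : I -> V) :
  linear l -> l (\sum_(i <- s) c i *: x i) = \sum_(i <- s) c i * l (x i).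
Proof.
move=> llin; have l0 : l 0 = 0 by have := llin (-1) 0 0; rewrite !scaleN1r !addNr.
elim: s => [|i s IH]; first by rewrite !big_nil.
by rewrite !big_cons llin IH.
Qed.

Lemma sum_indicator (K : numFieldType) (I : eqType) (s : seq I) (c : I -> K) v :
  uniq s -> \sum_(i <- s) c i * (v == i)%:R = if v \in s then c v else 0.
Proof.
move=> us; case: ifPn => vs.
  rewrite (bigD1_seq v)//= eqxx mulr1 big1 ?addr0// => i iv.
  by rewrite eq_sym (negbTE iv) mulr0.
rewrite big_seq big1// => i si; case: eqP => [vi|]; last by rewrite mulr0.
by rewrite vi si in vs.
Qed.

Section FiniteDimension.
Context (K : numFieldType) (V : lmodType K).

(** If [S] is spanned by [n] vectors, more than [n] indices in [D] would factor an identity matrix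
    of size above [n] through dimension [n], against the rank bound. *)
Lemma finite_dim_biorthogonal (I : choiceType) (D : set I) (S : set V)
    (x : I -> V) (ev : I -> V -> K^o) :
  finite_dim S -> (forall i, D i -> S (x i)) -> (forall i, linear (ev i)) ->
  (forall i j, D i -> D j -> ev i (x j) = (i == j)%:R) ->
  finite_set D.
Proof.
move=> [n [e ->]] xS evlin evx; apply: contrapT => Dinf.
have [B BD nB] := infinite_set_fset n.+1 Dinf.
pose m := size (enum_fset B); pose b (i : 'I_m) := tnth (in_tuple (enum_fset B)) i.
have Db i : D (b i) by apply: BD; exact: mem_tnth.
have b_inj : injective b by apply/tuple_uniqP; exact: fset_uniq.
have /choice[c xc] (i : 'I_m) :
    exists c : 'I_n -> K, x (b i) = \sum_(k < n) c k *: e k := xS _ (Db i).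
have : (\matrix_(i < m, k < n) c i k) *m (\matrix_(k < n, j < m) (ev (b j) (e k) : K))
    = 1%:M.
  apply/matrixP => i j; rewrite !mxE.
  transitivity (ev (b j) (x (b i)) : K).
    by rewrite xc linear_combE//; apply: eq_bigr => k _; rewrite !mxE.
  by rewrite evx// (inj_eq b_inj) eq_sym.
move=> /(congr1 (@mxrank _ _ _)) r1.
have := mulmx_max_rank (\matrix_(i < m, k < n) c i k)
  (\matrix_(k < n, j < m) (ev (b j) (e k) : K)).
by rewrite r1 mxrank1 leqNgt nB.
Qed.

Lemma finite_dim_span (I : eqType) (D : set I) (S : set V) (x : I -> V) :
  finite_set D -> S 0 -> (forall a u v, S u -> S v -> S (a *: u + v)) ->
  (forall i, D i -> S (x i)) ->
  (forall s : seq I, uniq s -> D = [set` s] -> forall y, S y ->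
    exists c : I -> K, y = \sum_(i <- s) c i *: x i) ->
  finite_dim S.
Proof.
move=> /finite_seqP[s0 Ds0] S0 Slin xS Sspan.
have [s us Ds] : exists2 s, uniq s & D = [set` s].
  exists (undup s0); first exact: undup_uniq.
  by rewrite Ds0; apply/seteqP; split => i /=; rewrite mem_undup.
exists (size s), (fun k => x (tnth (in_tuple s) k)); apply/seteqP; split => y /=.
  move=> /(Sspan _ us Ds)[c ->]; exists (fun k => c (tnth (in_tuple s) k)).
  by rewrite (big_tnth _ _ s).
move=> [c ->]; elim/big_ind : _ => //.
  by move=> u v Su Sv; rewrite -[u]scale1r; exact: Slin.
move=> k _; rewrite -[_ *: _]addr0; apply: Slin => //; apply: xS.
by rewrite Ds /=; exact: mem_tnth.
Qed.

End FiniteDimension.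

(** * Point masses, closures and bounded functionals on the weighted space *)

Section Linf.
Context (R : realType) (T : choiceType) (mu : T -> {posnum R}).
Implicit Types (f g : Linf mu) (v w : T).

Lemma LinfP (h : T -> R[i]) (M : R) :
  (forall v, weighted_mod mu h v <= M) -> exists f, f = h :> (T -> R[i]).
Proof.
move=> hM; have hL : h \in Linf_pred mu by apply/Linf_predP; exists M.
by exists (MkLinf hL).
Qed.

Lemma weighted_mod_delta w v :
  weighted_mod mu (fun u => (u == w)%:R) v = (v == w)%:R * (mu w)%:num.
Proof.
rewrite /weighted_mod; have [->|_] := eqVneq v w.
  by rewrite (modulus_realC 1) normr1 mulr1 mul1r.
by rewrite (modulus_realC 0) normr0 mulr0 mul0r.
Qed.

Lemma delta_Linf w : (fun u => (u == w)%:R : R[i]) \in Linf_pred mu.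
Proof.
apply/Linf_predP; exists (mu w)%:num => v.
by rewrite weighted_mod_delta ler_piMl// lern1 leq_b1.
Qed.

Definition Linf_delta w : Linf mu := MkLinf (delta_Linf w).

Lemma Linf_norm_delta w : Linf_norm (Linf_delta w) <= (mu w)%:num.
Proof.
apply: Linf_norm_le => // v.
by rewrite weighted_mod_delta ler_piMl// lern1 leq_b1.
Qed.

Lemma Linf_sumE (I : Type) (s : seq I) (c : I -> R[i]) (F : I -> Linf mu) v :
  (\sum_(i <- s) c i *: F i) v = \sum_(i <- s) c i * F i v.
Proof.
elim: s => [|i s IH]; first by rewrite !big_nil.
by rewrite !big_cons -IH.
Qed.

Lemma closure_LinfP (A : set (Linf mu)) g :
  closure A g <->
  forall e : R, 0 < e -> exists2 f, A f & Linf_norm (g - f) < e.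
Proof.
split=> [gA e e0|gA B].
  have e0C : 0 < e%:C :> R[i] by rewrite ltcR.
  have [f [Af]] := gA _ (nbhsx_ballx g _ e0C).
  by rewrite -ball_normE /ball_ /= Linf_normE ltcR; exists f.
move=> /nbhs_ballP[r /= r0 gB]; have [re e0] := gt0_complexE r0.
have [f Af gf] := gA _ e0; exists f; split => //; apply: gB.
by rewrite -ball_normE /ball_ /= Linf_normE re ltcR.
Qed.

(** The constant in [bounded_op] is a complex number; only its real part matters, and adding 1 makes
    the bound strictly positive. *)
Lemma bounded_op_real (W : normedModType R[i]) (A : Linf mu -> W) : bounded_op A ->
  exists2 C : R, 0 < C & forall f, `|A f| <= (C * Linf_norm f)%:C.
Proof.
move=> [_ [M AM]]; exists (`|complex.Re M| + 1) => [|f].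
  by rewrite ltr_wpDl.
apply: (le_trans (AM f)).
have := le_trans (normr_ge0 (A f)) (AM f).
rewrite Linf_normE; set n := Linf_norm f; case: M {AM} => a b /=.
have -> : (a +i* b) * n%:C = (a * n) +i* (b * n).
  by apply/eqP; rewrite eq_complex /= !mulr0 subr0 add0r !eqxx.
(* Comparability with 0 forces the imaginary part [b * n] to vanish. *)
rewrite lecE => /andP[/= /eqP-> _].
rewrite -[_ +i* 0]/((a * n)%:C) lecR ler_wpM2r ?Linf_norm_ge0//.
by rewrite (le_trans (ler_norm a))// lerDl.
Qed.

Lemma dual_closure (l : Linf mu -> R[i]^o) (A : set (Linf mu)) g :
  dual_space l -> (forall f, A f -> l f = 0) -> closure A g -> l g = 0.
Proof.
move=> ldual lA /closure_LinfP gA; have [C C0 lC] := bounded_op_real ldual.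
have [llin _] := ldual.
apply/eqP/negPn/negP => lg0.
have mlg0 : 0 < modulus (l g) by rewrite -ltcR -modulusE normr_gt0.
have [f Af gf] := gA _ (divr_gt0 mlg0 C0).
have := lC (g - f); rewrite -scaleN1r addrC llin (lA _ Af) scaler0 add0r.
rewrite scaleN1r addrC (modulusE (l g)) lecR leNgt => /negP; apply.
by rewrite mulrC -ltr_pdivlMr.
Qed.

End Linf.

(** * The operator, the section of the fibers and the range relations *)

Section WeightedComposition.
Context (R : realType) (T : choiceType) (mu : T -> {posnum R}).
Context (psi : T -> R[i]) (phi : T -> T) (W : Linf mu -> Linf mu).
Context (WE : forall f : Linf mu, W f = wcomp psi phi f :> (T -> R[i])).
Context (Wb : bounded_op W).

Lemma W_apply f v : W f v = psi v * f (phi v).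
Proof. by rewrite WE. Qed.

Let rho v : R := (mu v)%:num / (mu (phi v))%:num * modulus (psi v).

Let rho_ge0 v : 0 <= rho v.
Proof. by rewrite mulr_ge0 ?modulus_ge0. Qed.

Let weighted_mod_wcomp h v :
  weighted_mod mu (wcomp psi phi h) v = rho v * weighted_mod mu h (phi v).
Proof.
rewrite /weighted_mod /wcomp [modulus (_ * _)]Normc.normcM /rho.
rewrite mulrA [RHS]mulrACA divfK//.
by rewrite mulrA.
Qed.

(** Testing [W] on the point mass at [phi v] bounds [rho v] by the operator constant. *)
Lemma wcomp_weight_bound : exists C : R, forall v, rho v <= C.
Proof.
have [C C0 WC] := bounded_op_real Wb; exists C => v.
have := WC (Linf_delta mu (phi v)); rewrite Linf_normE lecR => le1.
have := le_trans (weighted_mod_le_norm _ v) le1.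
rewrite WE weighted_mod_wcomp weighted_mod_delta eqxx mul1r => le2.
have := le_trans le2 (ler_wpM2l (ltW C0) (Linf_norm_delta mu (phi v))).
by rewrite ler_pM2r.
Qed.

Lemma fiber_section : exists r : T -> T, forall v,
  phi (r (phi v)) = phi v /\ (psi v != 0 -> psi (r (phi v)) != 0).
Proof.
have [u|r rP] := @choice T T (fun u w => forall v, phi v = u ->
    phi w = u /\ (psi v != 0 -> psi w != 0)); last by exists r => v; exact: rP.
have [[w [wu w0]]|no] := pselect (exists w, phi w = u /\ psi w != 0).
  by exists w.
have [[w wu]|nou] := pselect (exists w, phi w = u).
  by exists w => v vu; split=> // v0; exfalso; apply: no; exists v.
by exists u => v vu; exfalso; apply: nou; exists v.
Qed.

Context (r : T -> T).
Context (phi_r : forall v, phi (r (phi v)) = phi v).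
Context (psi_r : forall v, psi v != 0 -> psi (r (phi v)) != 0).

(* If [psi] vanishes on the fiber of [phi v], the division by 0 yields 0 and
   the relation correctly reads [f v = 0]. *)
Definition range_relation v (f : Linf mu) : R[i]^o :=
  f v - psi v / psi (r (phi v)) * f (r (phi v)).

Definition redundant : set T := [set v | v != r (phi v) \/ psi v = 0].

Let slope v := psi v / psi (r (phi v)).

Let slopeK v : slope v * psi (r (phi v)) = psi v.
Proof.
rewrite /slope; have [v0|v0] := eqVneq (psi v) 0; first by rewrite v0 !mul0r.
by rewrite divfK ?psi_r.
Qed.

Lemma range_relation_W v f : range_relation v (W f) = 0.
Proof.
by rewrite /range_relation !W_apply phi_r -/(slope v) mulrA slopeK subrr.
Qed.

Lemma range_relation_dual v : dual_space (range_relation v).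
Proof.
(* Evaluation at a point is bounded, and a relation combines two evaluations. *)
have point u (f : Linf mu) : modulus (f u) <= (mu u)%:num^-1 * Linf_norm f.
  by rewrite mulrC ler_pdivlMr// mulrC; exact: weighted_mod_le_norm.
have modulusN (z : R[i]) : modulus (- z) = modulus z.
  by case: z => x y; rewrite /= !sqrrN.
split=> [a f g|].
  have E u : (a *: f + g) u = a * f u + g u by [].
  rewrite /range_relation !E -[a *: _]/(a * _) mulrBr mulrDr opprD addrACA.
  by rewrite (mulrCA _ a).
exists ((mu v)%:num^-1 + modulus (slope v) * (mu (r (phi v)))%:num^-1)%:C => f.
rewrite Linf_normE -rmorphM -[leLHS]/(`|_ : R[i]|) modulusE lecR mulrDl.
apply: (le_trans (modulusD _ _)); rewrite modulusN Normc.normcM -mulrA.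
by rewrite lerD ?ler_wpM2l ?modulus_ge0.
Qed.

(** If [w = r (phi v)], then [w] represents its own fiber, so it can only be redundant through
    [psi w = 0]; the choice of [r] then gives [psi v = 0], and the second term drops out. *)
Lemma range_relation_delta v w : redundant w ->
  range_relation v (Linf_delta mu w) = (v == w)%:R.
Proof.
move=> wB; rewrite /range_relation /=.
have [rw|_] := eqVneq (r (phi v)) w; last by rewrite mulr0 subr0.
have [v0|v0] := eqVneq (psi v) 0; first by rewrite v0 mul0r mul0r subr0.
by move: (psi_r v0) wB; rewrite -rw /redundant /= phi_r eqxx => /eqP ? [].
Qed.

Lemma range_relation_nonredundant v f : ~ redundant v -> range_relation v f = 0.
Proof.
move=> vB; rewrite /range_relation.
have [/eqP vr|] := boolP (v == r (phi v)); last by move=> vr; case: vB; left.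
have v0 : psi v != 0 by apply/eqP => v0; apply: vB; right.
by rewrite -vr divff// mul1r subrr.
Qed.

Lemma ker_supp f : W f = 0 <-> forall v, psi v != 0 -> f (phi v) = 0.
Proof.
split=> [Wf v v0|f0].
  have /eqP : W f v = 0 by rewrite Wf.
  by rewrite W_apply mulf_eq0 (negbTE v0) => /eqP.
apply/val_inj/funext => v /=; rewrite W_apply.
by have [->|/f0->] := eqVneq (psi v) 0; rewrite ?mul0r ?mulr0.
Qed.

Lemma fredholm_redundant_finite : fredholm W -> finite_set redundant.
Proof.
move=> [_ _ _ dualfin].
apply: (@finite_dim_biorthogonal _ _ _ _ _ range_relation
  (fun w l => l (Linf_delta mu w)) dualfin).
- move=> v _; split; first exact: range_relation_dual.
  by apply/funext => f; exact: range_relation_W.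
- by [].
- by move=> w v wB vB; rewrite range_relation_delta// eq_sym.
Qed.

Lemma fredholm_range_cofinite : fredholm W -> finite_set (~` range phi).
Proof.
move=> [_ _ kerfin _].
apply: (@finite_dim_biorthogonal _ _ _ _ _ (Linf_delta mu)
  (fun w f => f w) kerfin).
- move=> w wN; apply/ker_supp => v _ /=.
  by case: eqP => // vw; case: wN; exists v.
- by [].
- by move=> w v wB vB /=.
Qed.

(** * Redundant points against conditions (b), (c) and (d) *)

Lemma redundant_zeros : zeros psi `<=` redundant.
Proof. by move=> v; right. Qed.

Lemma redundant_nonsingleton :
  range phi `\` [set w | exists! v, phi v = w] `<=` phi @` redundant.
Proof.
move=> _ [[v _ <-]]; apply: contra_notP => no; exists (r (phi v)); split.
  exact: phi_r.
move=> w wv; apply: contrapT => /eqP wr; apply: no; exists w => //.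
by left; rewrite wv eq_sym.
Qed.

Lemma redundant_fiber_card : finite_set redundant ->
  exists M : nat, forall w, range phi w -> phi @^-1` [set w] #<= `I_M.
Proof.
move=> /finite_seqP[s Bs]; exists (size s).+1 => w _.
(* Only [r w] can lie in the fiber and outside [s]. There [index] takes the value [size s], which
   accounts for the successor in the bound. *)
have inj : {in phi @^-1` [set w] &, injective (fun v => index v s)}.
  have notB v : phi v = w -> v \notin s -> v = r w.
    move=> vw /negP vs; apply: contrapT => /eqP vr; apply: vs.
    suff: redundant v by rewrite Bs.
    by left; rewrite vw.
  move=> u v; rewrite !inE /= => uw vw uv.
  have [us|us] := boolP (u \in s).
    have vs : v \in s by rewrite -index_mem -uv index_mem.
    by rewrite -(nth_index u us) uv nth_index.
  have vs : v \notin s by rewrite -index_mem -uv index_mem.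
  by rewrite (notB u)// (notB v).
rewrite -(card_le_eql (inj_card_eq inj)); apply: subset_card_le.
by move=> _ [v _ <-] /=; rewrite ltnS index_size.
Qed.

Lemma finite_redundant :
  (forall w, range phi w -> finite_set (phi @^-1` [set w])) ->
  finite_set (range phi `\` [set w | exists! v, phi v = w]) ->
  finite_set (zeros psi) -> finite_set redundant.
Proof.
move=> fib nonsing zer.
apply: (@sub_finite_set _ _ (zeros psi `|`
  \bigcup_(w in range phi `\` [set w | exists! v, phi v = w]) phi @^-1` [set w])).
  move=> v [vr|]; last by left.
  right; exists (phi v) => //; split; first by exists v.
  move=> [w [_ wP]]; move/eqP: vr; apply.
  by transitivity w; [exact/esym/wP | exact: wP].
by rewrite finite_setU; split=> //; apply: bigcup_finite => // w [/fib].
Qed.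

(** * Consequences of (e) for the range and the dual kernel *)

Section LevelSet.
Context (eps : R).
Context (eps0 : 0 < eps).
Context (levelP : forall w, (~` zeros psi) w ->
  level_set mu psi phi eps `&` fiber_of phi w !=set0).

Lemma range_relationP g :
  (forall v, range_relation v g = 0) -> range W g.
Proof.
move=> g0.
have gE v : g v = slope v * g (r (phi v)) by apply/eqP; rewrite -subr_eq0; apply/eqP/g0.
(* The candidate preimage divides by [psi] at the chosen points; the test [phi (r u) == u] detects
   the range of [phi]. *)
pose h u := if phi (r u) == u then g (r u) / psi (r u) else 0.
have hphi v : psi v * h (phi v) = g v.
  by rewrite /h phi_r eqxx [RHS]gE mulrA mulrAC.
have [u|f fh] := @LinfP _ _ mu h (Linf_norm g / eps).
  have [hu0|hu0] := eqVneq (h u) 0.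
    rewrite /weighted_mod hu0 Normc.normc0 mulr0.
    by rewrite divr_ge0 ?Linf_norm_ge0// ltW.
  have ru : phi (r u) = u by apply/eqP; move: hu0; rewrite /h; case: ifP; rewrite ?eqxx.
  have ru0 : psi (r u) != 0.
    by apply: contra hu0 => /eqP e; rewrite /h e invr0 mulr0 if_same.
  (* The fiber of [u] contains [v] with [eps <= rho v], so [eps] times the weighted modulus of [h]
     at [u] is at most that of [g] at [v]. *)
  have [v [vU vr]] : level_set mu psi phi eps `&` fiber_of phi (r u) !=set0.
    by apply: levelP => /eqP; exact/negP.
  have vu : phi v = u by rewrite vr ru.
  rewrite ler_pdivlMr// mulrC.
  apply: le_trans (weighted_mod_le_norm g v).
  have -> : Linf_fun g = wcomp psi phi h by apply/funext => z; rewrite -hphi.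
  by rewrite weighted_mod_wcomp vu ler_wpM2r ?weighted_mod_ge0.
exists f => //; apply/val_inj/funext => v /=.
by rewrite W_apply fh hphi.
Qed.

(** The range is an intersection of kernels of bounded functionals. *)
Lemma closed_range : closed (range W).
Proof.
move=> g gcl; apply: range_relationP => v.
apply: (dual_closure (range_relation_dual v) _ gcl) => _ [f _ <-].
exact: range_relation_W.
Qed.

Lemma finite_dim_dual_ker : finite_set redundant ->
  finite_dim (@dual_space _ _ `&` [set l | adjoint W l = 0]).
Proof.
move=> Bfin; apply: (finite_dim_span (x := range_relation) Bfin).
- split; last exact: funext.
  by split=> [a f g|]; [rewrite scaler0 addr0|exists 0 => f; rewrite mul0r normr0].
- move=> a l k [[llin [M lM]] lW] [[klin [N kN]] kW]; split.
    split=> [b f g|].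
      rewrite -[LHS]/(a *: l (b *: f + g) + k (b *: f + g)) llin klin.
      by rewrite !scalerDr addrACA scalerA mulrC -scalerA.
    exists (`|a| * M + N) => f; apply: (le_trans (ler_normD (a * l f) (k f))).
    by rewrite mulrDl normrM -mulrA lerD// ler_wpM2l.
  rewrite /= -[LHS]/(a *: adjoint W l + adjoint W k) lW kW scaler0 addr0//.
- move=> v _; split; first exact: range_relation_dual.
  by apply/funext => f; exact: range_relation_W.
move=> s us Bs l [[llin lb] lW].
exists (fun v => l (Linf_delta mu v)); apply/funext => g.
have sub (k : Linf mu -> R[i]^o) f1 f2 : linear k -> k (f1 - f2) = k f1 - k f2.
  by move=> klin; rewrite -scaleN1r addrC klin scaleN1r addrC.
(* By biorthogonality, subtracting [P] makes every relation hold, so [g - P] is in the range and [l]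
   kills it; thus [l g = l P] expands in the relations. *)
pose P := \sum_(v <- s) range_relation v g *: Linf_delta mu v.
have [f _ Wf] : range W (g - P).
  apply: range_relationP => v.
  have [vB|] := pselect (redundant v); last exact: range_relation_nonredundant.
  have [rlin _] := range_relation_dual v.
  rewrite sub// linear_combE//; apply/eqP; rewrite subr_eq0; apply/eqP.
  transitivity (\sum_(w <- s) range_relation w g * (v == w)%:R); last first.
    apply: eq_big_seq => w ws; rewrite range_relation_delta//.
    by rewrite Bs.
  by rewrite sum_indicator// ifT//; move: vB; rewrite Bs.
have : l (g - P) = 0 by rewrite -Wf -[LHS]/(adjoint W l f) lW.
rewrite sub// linear_combE// fct_sumE => /eqP; rewrite subr_eq0 => /eqP ->.
by apply: eq_bigr => v _; rewrite mulrC.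
Qed.

End LevelSet.

(** * The kernel, and the necessity of (e) *)

Lemma finite_dim_ker :
  finite_set (~` (phi @` (~` zeros psi))) -> finite_dim [set f | W f = 0].
Proof.
move=> Nfin; have [Wlin _] := Wb.
apply: (finite_dim_span (x := Linf_delta mu) Nfin).
- by rewrite /=; apply/ker_supp.
- move=> a f g /= /ker_supp f0 /ker_supp g0; apply/ker_supp => v v0.
  by rewrite -[LHS]/(a * f (phi v) + g (phi v)) f0// g0// mulr0 addr0.
- move=> w wN; apply/ker_supp => v v0 /=; case: eqP => // vw; case: wN.
  by exists v => //; exact/eqP.
move=> s us Ns f /ker_supp f0; exists f; apply/val_inj/funext => v.
rewrite /= Linf_sumE sum_indicator//; case: ifPn => // /negP vs.
have [[w w0 <-]|vN] := pselect ((phi @` (~` zeros psi)) v).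
  by apply: f0; exact/eqP.
by exfalso; apply: vs; have : (~` (phi @` (~` zeros psi))) v by []; rewrite Ns.
Qed.

Lemma closed_range_level : closed (range W) ->
  exists2 eps : R, 0 < eps & forall w, (~` zeros psi) w ->
    level_set mu psi phi eps `&` fiber_of phi w !=set0.
Proof.
move=> Wcl; have [C rhoC] := wcomp_weight_bound.
pose a u := sup (rho @` (phi @^-1` [set u])).
have rhoa v : rho v <= a (phi v).
  apply: ub_le_sup; last by exists v.
  by exists C => _ [w _ <-].
(* The maximum with 0 covers empty fibers, where [sup] is 0. *)
have aC u : a u <= Num.max C 0.
  rewrite /a; have [->|/set0P ne] := eqVneq (rho @` (phi @^-1` [set u])) set0.
    by rewrite sup0 le_max lexx orbT.
  by apply: ge_sup => // _ [w _ <-]; rewrite le_max rhoC.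
pose q u := Num.sqrt (a u).
(* The square root balances the two sides: [h] has weighted modulus [1 / q], large where [a] is
   small, while its image has weighted modulus at most [q], since [rho v <= q (phi v) ^ 2]. *)
pose h u : R[i] := ((mu u)%:num * q u)^-1%:C.
have q0 u : 0 <= q u by exact: sqrtr_ge0.
have weighted_h u : weighted_mod mu h u = (q u)^-1.
  rewrite /weighted_mod /h modulus_realC ger0_norm ?invr_ge0 ?mulr_ge0//.
  by rewrite invfM mulrA divff// mul1r.
have weighted_g v : weighted_mod mu (wcomp psi phi h) v <= q (phi v).
  rewrite weighted_mod_wcomp weighted_h; have [->|qn0] := eqVneq (q (phi v)) 0.
    by rewrite invr0 mulr0.
  rewrite ler_pdivrMr; last by rewrite lt_neqAle eq_sym qn0 q0.
  by rewrite -expr2 sqr_sqrtr// (le_trans (rho_ge0 v)).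
have [v|g gE] := @LinfP _ _ mu (wcomp psi phi h) (Num.sqrt (Num.max C 0)).
  by apply: (le_trans (weighted_g v)); exact: ler_wsqrtr.
have [f _ fg] : range W g.
  apply: Wcl; apply/closure_LinfP => e e0; have e20 : 0 < e / 2 by rewrite divr_gt0.
  (* The truncation is bounded by [2 / e], and its image differs from [g] only where
     [q (phi v) < e / 2], hence by less than [e / 2] in weighted modulus. *)
  pose ht u := if e / 2 <= q u then h u else 0.
  have [u|f fE] := @LinfP _ _ mu ht (e / 2)^-1.
    rewrite /weighted_mod /ht; case: ifP => [equ|_].
      by rewrite -/(weighted_mod mu h u) weighted_h lef_pV2// posrE (lt_le_trans e20).
    by rewrite Normc.normc0 mulr0 invr_ge0 ltW.
  exists (W f); first by exists f.
  apply: (@le_lt_trans _ _ (e / 2)); last by rewrite gtr_pMr// invf_lt1// ltr1n.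
  apply: Linf_norm_le => [|v]; first exact: ltW.
  rewrite /weighted_mod -[X in modulus X]/(g v - W f v) W_apply gE fE /wcomp -mulrBr /ht.
  case: ifPn => [_|]; first by rewrite subrr mulr0 Normc.normc0 mulr0 ltW.
  by rewrite -ltNge subr0 => /ltW; apply: le_trans; exact: weighted_g.
pose B := Linf_norm f + 1.
have B0 : 0 < B by rewrite ltr_wpDl ?Linf_norm_ge0.
have aB w : psi w != 0 -> B ^- 2 <= a (phi w).
  move=> w0.
  have rhow : 0 < rho w.
    rewrite mulr_gt0// lt_neqAle modulus_ge0 andbT eq_sym.
    by apply: contra w0 => /eqP/Normc.eq0_normc ->.
  have aw : 0 < a (phi w) by apply: lt_le_trans (rhoa w).
  (* Cancelling [psi w] identifies the preimage [f] with [h], so [1 / q (phi w) <= B]. *)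
  have fh : f (phi w) = h (phi w).
    by apply: (mulfI w0); rewrite -W_apply fg gE.
  have : weighted_mod mu f (phi w) <= B.
    by apply: (le_trans (weighted_mod_le_norm _ _)); rewrite lerDl.
  rewrite /weighted_mod fh -/(weighted_mod mu h (phi w)) weighted_h.
  have qw : 0 < q (phi w) by rewrite sqrtr_gt0.
  rewrite -[X in _ <= X]invrK lef_pV2 ?posrE ?invr_gt0// => Bq.
  rewrite -[a (phi w)](sqr_sqrtr (ltW aw)) -exprVn.
  by rewrite ler_pXn2r ?nnegrE ?invr_ge0 ?(ltW B0) ?(ltW qw).
(* Halving puts the threshold strictly below the supremum [a (phi w)], so some point of the fiber
   exceeds it. *)
exists (B ^- 2 / 2) => [|w /eqP w0]; first by rewrite divr_gt0 ?invr_gt0 ?exprn_gt0.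
have lta : B ^- 2 / 2 < a (phi w).
  apply: lt_le_trans (aB w w0).
  by rewrite gtr_pMr ?invf_lt1 ?ltr1n// invr_gt0 exprn_gt0.
have [|_ [v vw <-] vlt] := sup_gt _ lta; first by exists (rho w), w.
by exists v; split => //; exact: ltW.
Qed.

End WeightedComposition.

Theorem theorem7p7 (R : realType) (T : metricType R) (o : T)
    (T_locally_finite : forall M : R, 0 < M ->
      finite_set [set v : T | mdist o v < M])
    (T_unbounded : forall M : R, 0 < M -> exists v : T, M <= mdist o v)
    (mu : T -> {posnum R}) (psi : T -> R[i]) (phi : T -> T)
    (W : Linf mu -> Linf mu)
    (W_wcomp : forall f : Linf mu, W f = wcomp psi phi f :> (T -> R[i]))
    (W_bounded : bounded_op W) :
  fredholm W <->
  [/\ finite_set (~` range phi),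
      exists M : nat, forall w, range phi w -> phi @^-1` [set w] #<= `I_M,
      finite_set (range phi `\` [set w | exists! v, phi v = w]),
      finite_set (zeros psi) &
      exists2 eps : R, 0 < eps &
        forall w, (~` zeros psi) w ->
          level_set mu psi phi eps `&` fiber_of phi w !=set0].

Proof.
have [r rP] := fiber_section psi phi.
have phi_r v : phi (r (phi v)) = phi v by have [] := rP v.
have psi_r v : psi v != 0 -> psi (r (phi v)) != 0 by have [] := rP v.
split=> [Wfred|[rangefin [M fibM] nonsing zer [eps eps0 levelP]]].
  have Bfin := fredholm_redundant_finite W_wcomp phi_r psi_r Wfred.
  split.
  - exact: (fredholm_range_cofinite W_wcomp).
  - exact: redundant_fiber_card Bfin.
  - apply: sub_finite_set (finite_image phi Bfin).
    exact: redundant_nonsingleton.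
  - exact: sub_finite_set (@redundant_zeros _ _ psi phi r) Bfin.
  - by have [_ Wcl _ _] := Wfred; exact: (closed_range_level W_wcomp).
have Bfin : finite_set (redundant psi phi r).
  apply: finite_redundant => // w /fibM /card_le_finite; apply.
  exact: finite_II.
split=> //.
- exact: (closed_range W_wcomp phi_r psi_r eps0).
- apply: (finite_dim_ker W_wcomp W_bounded).
  (* A point of the range missed by the nonzeros of [psi] is the image of a zero. *)
  apply: (@sub_finite_set _ _ (~` range phi `|` phi @` zeros psi)).
    move=> u uN; have [[v _ vu]|] := pselect (range phi u); last by left.
    right; exists v => //; apply: contrapT => v0; apply: uN.
    by exists v.
  by rewrite finite_setU; split=> //; exact: finite_image.
- exact: (finite_dim_dual_ker W_wcomp phi_r psi_r eps0).
Qed.
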